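(* Let $G_1$ and $G_2$ be graphs with $\chi(G_1)=k_1$, $\chi(G_2)=k_2$ and $k_1\le k_2$. Then for every integer $r$ with $r\le k_1+1$ (and $0<r\le \Delta(G_1+G_2)$), $\chi_r(G_1+G_2)=\chi(G_1+G_2)=k_1+k_2$.
   Context: All graphs are simple, connected and undirected. For a vertex $v$, $N_G(v)$ is its open neighborhood and $d(v)=|N_G(v)|$; $\Delta$ is the maximum degree. For a set $S$ of vertices and a coloring $c$, $c(S)=\{c(u):u\in S\}$. For integers $k>0$ and $0<r\le\Delta(G)$ with $r\le k$, a conditional $(k,r)$-coloring of $G$ is a surjective map $c:V(G)\to\{1,\dots,k\}$ such that (C1) $c(u)\ne c(v)$ whenever $uv\in E(G)$, and (C2) $|c(N_G(v))|\ge\min\{d(v),r\}$ for every vertex $v$. The $r$th order conditional chromatic number $\chi_r(G)$ is the smallest $k$ for which $G$ has a conditional $(k,r)$-coloring. The join $G_1+G_2$ has vertex set $V(G_1)\cup V(G_2)$ (disjoint) and edge set $E(G_1)\cup E(G_2)\cup\{u_1u_2: u_1\in V(G_1),u_2\in V(G_2)\}$. *)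

(* Defs.v *)
From mathcomp Require Import all_boot.

Set Implicit Arguments.
Unset Strict Implicit.
Unset Printing Implicit Defensive.

Record sgraph := SGraph {
  vertex :> finType;
  edge : rel vertex;
  edge_sym : symmetric edge;
  edge_irr : irreflexive edge }.

(* The null graph is not counted as connected. *)
Definition connected (G : sgraph) : Prop :=
  0 < #|G| /\ forall u v : G, connect (@edge G) u v.

Definition nbhd (G : sgraph) (v : G) : {set G} := [set u | edge v u].

Definition deg (G : sgraph) (v : G) : nat := #|nbhd v|.

Definition max_deg (G : sgraph) : nat := \max_(v : G) deg v.

Section Join.

Variables G1 G2 : sgraph.

Definition join_edge : rel (G1 + G2)%type := fun x y =>
  match x, y with
  | inl u, inl v => edge u v
  | inr u, inr v => edge u v
  | _, _ => true
  end.

Lemma join_edge_sym : symmetric join_edge.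
Proof. by move=> [u|u] [v|v] //=; apply: edge_sym. Qed.

Lemma join_edge_irr : irreflexive join_edge.
Proof. by move=> [u|u] /=; apply: edge_irr. Qed.

Definition join : sgraph := SGraph join_edge_sym join_edge_irr.

End Join.

Section Colorings.

Variables (G : sgraph) (k : nat).
Implicit Type c : {ffun G -> 'I_k}.

Definition proper_coloring c : bool :=
  [forall u, forall v, edge u v ==> (c u != c v)].

Definition cond_coloring (r : nat) c : bool :=
  [&& 0 < k, 0 < r <= max_deg G, r <= k,
      [forall i, exists v, c v == i],
      proper_coloring c &
      [forall v, minn (deg v) r <= #|c @: nbhd v|]].

End Colorings.

Definition colorable (G : sgraph) : pred nat :=
  fun k => [exists c : {ffun G -> 'I_k}, proper_coloring c].

Definition cond_colorable (G : sgraph) (r : nat) : pred nat :=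
  fun k => [exists c : {ffun G -> 'I_k}, cond_coloring r c].

Lemma proper_enum_rank (G : sgraph) : proper_coloring [ffun v : G => enum_rank v].
Proof.
apply/forallP=> u; apply/forallP=> v; apply/implyP=> uv.
rewrite !ffunE; apply/eqP=> /enum_rank_inj eq_uv.
by rewrite eq_uv edge_irr in uv.
Qed.

Lemma ex_colorable (G : sgraph) : exists k, colorable G k.
Proof.
by exists #|G|; apply/existsP; exists [ffun v : G => enum_rank v];
  apply: proper_enum_rank.
Qed.

Lemma ex_cond_colorable (G : sgraph) (r : nat) :
  0 < r <= max_deg G -> exists k, cond_colorable G r k.
Proof.
move=> hr; have /andP[r_gt0 r_le] := hr.
have le_rG : r <= #|G|.
  by apply: leq_trans r_le _; apply/bigmax_leqP=> v _; apply: max_card.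
exists #|G|; apply/existsP; exists [ffun v : G => enum_rank v].
rewrite /cond_coloring hr le_rG (leq_trans r_gt0 le_rG) proper_enum_rank /=.
apply/andP; split; apply/forallP=> i.
  by apply/existsP; exists (enum_val i); rewrite ffunE enum_valK.
rewrite card_imset ?geq_minl // => u v.
by rewrite !ffunE; apply: enum_rank_inj.
Qed.

Definition chi (G : sgraph) : nat := ex_minn (ex_colorable G).

(* Conditional colorings exist exactly when 0 < r <= max_deg G, so the number
   is only defined on such r and takes the proof as an argument. *)
Definition cond_chi (G : sgraph) (r : nat) (hr : 0 < r <= max_deg G) : nat :=
  ex_minn (ex_cond_colorable hr).

(* Main.v *)
Require Import Defs.
From mathcomp Require Import all_boot.

(** Both halves of a properly colored join use disjoint palettes, so at least
    [k1 + k2] colors occur, and optimal colorings of the halves glue to a proper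
    coloring with exactly [k1 + k2] colors, which is therefore onto.
    In this coloring a vertex of one half sees the whole palette of the other
    half, plus one more color as soon as it has a neighbor in its own half;
    this gives [k1 + 1] colors.  Otherwise, by connectedness, its half is a
    single vertex, so [r <= 2], and it only remains to see that a connected
    graph with at least two vertices needs two colors. *)

Set Implicit Arguments.
Unset Strict Implicit.
Unset Printing Implicit Defensive.

Lemma proper_coloringP (G : sgraph) (k : nat) (c : {ffun G -> 'I_k}) :
  reflect (forall u v, edge u v -> c u != c v) (proper_coloring c).
Proof.
apply: (iffP 'forall_'forall_implyP) => pc u v; exact: pc.
Qed.

Lemma chi_colorable (G : sgraph) : colorable G (chi G).
Proof. by rewrite /chi; case: ex_minnP. Qed.

Lemma chi_le (G : sgraph) (k : nat) : colorable G k -> chi G <= k.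
Proof. by rewrite /chi; case: ex_minnP => m _ min_m; apply: min_m. Qed.

Lemma chi_le_card_image (G : sgraph) (T : finType) (c : G -> T) :
  (forall u v, edge u v -> c u != c v) -> chi G <= #|c @: [set: G]|.
Proof.
move=> pc; have cP u : c u \in c @: [set: G] by apply: imset_f; rewrite inE.
apply: chi_le; apply/existsP.
exists [ffun u => enum_rank_in (cP u) (c u)]; apply/proper_coloringP => u v uv.
rewrite !ffunE; apply: contra (pc _ _ uv) => /eqP/(congr1 enum_val).
by rewrite !enum_rankK_in // => ->.
Qed.

(** A path from [u] to another vertex would start with an edge at [u]. *)
Lemma chi_isolated (G : sgraph) (u : G) :
  connected G -> nbhd u = set0 -> chi G <= 1.
Proof.
move=> [_ conn] nu0.
have all_u v : v = u.
  have /connectP[[|w p] //= /andP[uw _] _] := conn u v.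
  by have := in_set0 w; rewrite -nu0 inE uw.
apply: chi_le; apply/existsP; exists [ffun=> ord0].
by apply/proper_coloringP => v w; rewrite (all_u v) (all_u w) edge_irr.
Qed.

Lemma minn_card2_chi (G : sgraph) : connected G -> minn #|G| 2 <= chi G.
Proof.
move=> [/card_gt0P[u _] conn]; rewrite geq_min.
have /existsP[c /proper_coloringP pc] := chi_colorable G.
case: (ltnP 1 (chi G)) => [_|chi_le1]; rewrite ?orbT ?orbF //.
(* The color of [u] shows that [chi G] is positive. With a single color there are no edges, so
   connectedness leaves one vertex. *)
apply: (@leq_trans 1); last exact: leq_ltn_trans (leq0n (c u)) (ltn_ord (c u)).
apply/card_le1_eqP => v w _ _.
have /connectP[[|x p] //= /andP[vx _] _] := conn v w.
have /eqP[] := pc _ _ vx; apply: val_inj => /=.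
have small (i : 'I_(chi G)) : i = 0 :> nat.
  by apply/eqP; rewrite -leqn0 -ltnS (leq_trans (ltn_ord i)).
by rewrite !small.
Qed.

(* [f] and [g] are the embeddings of the two halves of a join [J]; keeping them
   abstract lets the same statement serve both halves. *)
Lemma cond_color_join_half (G H J : sgraph) (f : G -> J) (g : H -> J)
    (k r : nat) (c : {ffun J -> 'I_k}) (u : G) :
    nbhd (f u) = f @: nbhd u :|: g @: [set: H] ->
    (forall v w, edge v w -> edge (g v) (g w)) ->
    (forall v w, edge (f v) (g w)) ->
    connected G -> connected H -> proper_coloring c ->
    r <= (chi G).+1 -> r <= (chi H).+1 ->
  minn (deg (f u)) r <= #|c @: nbhd (f u)|.
Proof.
move=> nfu gE fgE connG connH /proper_coloringP pc rG rH.
have chiH : chi H <= #|c @: (g @: [set: H])|.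
  rewrite -imset_comp; apply: chi_le_card_image => v w vw /=.
  exact/pc/gE.
have [nu0|[v uv]] := set_0Vmem (nbhd u).
  have r2 : r <= 2 by apply: leq_trans rG _; rewrite ltnS (chi_isolated _ nu0).
  rewrite /deg nfu nu0 imset0 set0U.
  apply: leq_trans chiH; apply: leq_trans (minn_card2_chi connH).
  rewrite leq_min !geq_min r2 orbT andbT.
  by rewrite -[X in _ <= X]cardsT leq_imset_card.
rewrite geq_min; apply/orP; right; apply: leq_trans rH _.
(* The neighbor [f v] is adjacent to the whole other half, so its color is the extra one. *)
have notin : c (f v) \notin c @: (g @: [set: H]).
  apply/imsetP => -[_ /imsetP[w _ ->]] /eqP.
  by apply/negP/pc.
apply: (@leq_trans #|c (f v) |: c @: (g @: [set: H])|).
  by rewrite cardsU1 notin add1n ltnS.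
apply: subset_leq_card; rewrite nfu imsetU setUSS // sub1set.
by do 2!apply: imset_f.
Qed.

Lemma nbhd_join_inl (G1 G2 : sgraph) (u : G1) :
  nbhd (inl u : join G1 G2) = inl @: nbhd u :|: inr @: [set: G2].
Proof.
apply/setP => -[v|v]; rewrite !inE /=.
  rewrite (mem_imset _ _ (@inl_inj G1 G2)) inE.
  by rewrite [X in _ || X](_ : _ = false) ?orbF //; apply/imsetP => -[].
by rewrite (mem_imset _ _ (@inr_inj G1 G2)) inE orbT.
Qed.

Lemma nbhd_join_inr (G1 G2 : sgraph) (u : G2) :
  nbhd (inr u : join G1 G2) = inr @: nbhd u :|: inl @: [set: G1].
Proof.
apply/setP => -[v|v]; rewrite !inE /=.
  by rewrite (mem_imset _ _ (@inl_inj G1 G2)) inE orbT.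
rewrite (mem_imset _ _ (@inr_inj G1 G2)) inE.
by rewrite [X in _ || X](_ : _ = false) ?orbF //; apply/imsetP => -[].
Qed.

Lemma colorable_join (G1 G2 : sgraph) (k1 k2 : nat) :
  colorable G1 k1 -> colorable G2 k2 -> colorable (join G1 G2) (k1 + k2).
Proof.
move=> /existsP[c1 /proper_coloringP pc1] /existsP[c2 /proper_coloringP pc2].
(* [unsplit] shifts the colors of the second half by [k1], which keeps the palettes disjoint. *)
apply/existsP; exists [ffun x : join G1 G2 => unsplit
  match x with inl u => inl (c1 u) | inr u => inr (c2 u) end].
apply/proper_coloringP => x y xy; rewrite !ffunE (can_eq (@unsplitK _ _)).
case: x y xy => [u|u] [v|v] //= uv.
  exact: pc1.
exact: pc2.
Qed.

Lemma chi_join (G1 G2 : sgraph) : chi (join G1 G2) = chi G1 + chi G2.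
Proof.
apply/eqP; rewrite eqn_leq chi_le ?colorable_join ?chi_colorable //=.
have /existsP[c /proper_coloringP pc] := chi_colorable (join G1 G2).
pose c1 (u : G1) := c (inl u); pose c2 (u : G2) := c (inr u).
have le1 : chi G1 <= #|c1 @: [set: G1]|.
  by apply: chi_le_card_image => u v uv; apply: pc.
have le2 : chi G2 <= #|c2 @: [set: G2]|.
  by apply: chi_le_card_image => u v uv; apply: pc.
apply: leq_trans (leq_add le1 le2) _.
have /leqifP := leq_card_setU (c1 @: [set: G1]) (c2 @: [set: G2]).
have -> : [disjoint c1 @: [set: G1] & c2 @: [set: G2]].
  apply/pred0P => i /=; apply/negP => /andP[/imsetP[u _ ->] /imsetP[v _ /eqP]].
  exact/negP/pc.
by move=> /eqP <-; rewrite -[X in _ <= X]card_ord max_card.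
Qed.

(** A missed color would allow a proper coloring with fewer than [chi G] colors. *)
Lemma optimal_coloring_surj (G : sgraph) (c : {ffun G -> 'I_(chi G)}) i :
  proper_coloring c -> exists v, c v == i.
Proof.
move=> /proper_coloringP pc.
have : c @: [set: G] == setT.
  by rewrite eqEcard subsetT cardsT card_ord chi_le_card_image.
move=> /eqP/setP/(_ i); rewrite in_setT => /imsetP[v _ ->].
by exists v.
Qed.

Theorem theorem2p1 (G1 G2 : sgraph) (k1 k2 : nat)
    (conn1 : connected G1) (conn2 : connected G2)
    (chi1 : chi G1 = k1) (chi2 : chi G2 = k2) (le_k : k1 <= k2)
    (r : nat) (hr : 0 < r <= max_deg (join G1 G2)) (hrk : r <= k1 + 1) :
  cond_chi hr = chi (join G1 G2) /\ chi (join G1 G2) = k1 + k2.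
Proof.
split; last by rewrite chi_join chi1 chi2.
rewrite addn1 in hrk.
have r1 : r <= (chi G1).+1 by rewrite chi1.
have r2 : r <= (chi G2).+1 by rewrite chi2 (leq_trans hrk).
(* [G2] is nonempty and so uses a color; hence [chi G1 + 1], and with it [r], is at most
   [chi (join G1 G2)]. *)
have chi2_gt0 : 0 < chi G2.
  apply: leq_trans (minn_card2_chi conn2).
  by rewrite leq_min andbT; case: conn2.
rewrite /cond_chi; case: ex_minnP => m /existsP[c0 cc0] min_m.
apply/eqP; rewrite eqn_leq; apply/andP; split; last first.
  apply: chi_le; apply/existsP; exists c0.
  by case/and5P: cc0 => _ _ _ _ /andP[].
(* Any optimal proper coloring of the join serves, glued or not. *)
apply: min_m; have /existsP[c pc] := chi_colorable (join G1 G2).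
have r_le : r <= chi (join G1 G2).
  by apply: leq_trans r1 _; rewrite chi_join -addn1 leq_add2l.
apply/existsP; exists c; apply/and5P; split=> //; last (apply/andP; split=> //).
- by apply: leq_trans r_le; case/andP: hr.
- by apply/forallP => i; apply/existsP; apply: optimal_coloring_surj.
apply/forallP => -[u|u].
- exact: (cond_color_join_half (@nbhd_join_inl G1 G2 u)).
- exact: (cond_color_join_half (@nbhd_join_inr G1 G2 u)).
Qed.
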